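(* Let $n\ge2$, $1\le p\le n-1$, $r\in[n]$, and let $\pi\in S_n$ be a $p$-resultant permutation. There exists $\sigma\in S_{n-1}$ such that the configuration $\sigma^{(r,p)}$ topples to $\pi$ if and only if: (1) if $r\le n-p$, then $r$ is a left-to-right maximum of $\pi^{\text{left}}$; and (2) if $r>n-p$, then $r$ is a right-to-left minimum of $\pi^{\text{right}}$.
   Context: For $m\ge1$, $1\le p\le m$: sites are $0,\dots,m+1$; a configuration in $\mathcal{S}(m,p)$ places $m+1$ distinct chips labeled $1,\dots,m+1$ with sites $0,m+1$ empty, one chip at each site of $\{1,\dots,m\}\setminus\{p\}$ and two chips at site $p$. Toppling: while some site holds at least two chips, choose such a site $i$ and two chips $\alpha<\beta$ there and move $\alpha$ to $i-1$, $\beta$ to $i+1$. It is known this terminates with at most one chip per site and the final configuration is independent of the choices; reading labels left to right gives a permutation in $S_{m+1}$ to which the configuration topples. For $\sigma\in S_m$ and $r\in[m+1]$, $\sigma^{(r,p)}\in\mathcal{S}(m,p)$ places at site $i$ ($1\le i\le m$) chip $\sigma_i$ if $\sigma_i<r$ and $\sigma_i+1$ otherwise, plus chip $r$ at site $p$. $\pi\in S_n$ is $p$-resultant if some configuration in $\mathcal{S}(n-1,p)$ topples to it; then $\pi^{\text{left}}=(\pi_1,\dots,\pi_{n-p})$ is a permutation of $[n-p]$ and $\pi^{\text{right}}=(\pi_{n-p+1},\dots,\pi_n)$ of $\{n-p+1,\dots,n\}$. Left-to-right maximum of $a_1\cdots a_k$: an entry $a_j=\max\{a_1,\dots,a_j\}$;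 right-to-left minimum: an entry $a_j=\min\{a_j,\dots,a_k\}$. *)

(* Defs.v *)
From mathcomp Require Import all_boot all_order all_algebra.
Set Implicit Arguments. Unset Strict Implicit. Unset Printing Implicit Defensive.
Import Order.TTheory GRing.Theory Num.Theory.
Local Open Scope ring_scope.
Local Open Scope nat_scope.

(* Chips are labelled 1..N (N = number of chips).  A configuration is given
   by the site (an integer) of every chip: [pos : nat -> int]; only the
   values on labels 1..N matter. *)
Definition config := nat -> int.

Definition chip (N c : nat) : bool := (1 <= c <= N)%N.

Definition topple_step (N : nat) (pos pos' : config) : Prop :=
  exists a b : nat, [/\ (1 <= a)%N, (a < b)%N, (b <= N)%N, pos a = pos b &
    forall c, pos' c = (if c == a then pos a - 1
                        else if c == b then pos b + 1 else pos c)%R].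

Inductive topples_rt (N : nat) : config -> config -> Prop :=
| topples_refl pos : topples_rt N pos pos
| topples_trans pos pos' pos'' :
    topple_step N pos pos' -> topples_rt N pos' pos'' -> topples_rt N pos pos''.

Definition stable (N : nat) (pos : config) : Prop :=
  forall a b, chip N a -> chip N b -> a != b -> pos a != pos b.

Definition reading (N : nat) (pos : config) : seq nat :=
  sort (fun a b => (pos a <= pos b)%R) (iota 1 N).

Definition topples_to (N : nat) (pos : config) (pi : seq nat) : Prop :=
  exists pos', [/\ topples_rt N pos pos', stable N pos' & reading N pos' = pi].

Definition in_S (m p : nat) (pos : config) : Prop :=
  (forall c, chip m.+1 c -> (1 <= pos c)%R /\ (pos c <= m%:Z%R)%R) /\
  (forall i : nat, (1 <= i <= m)%N ->
     count (fun c => pos c == i%:Z%R) (iota 1 m.+1) = (if i == p then 2 else 1)%N).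

(* sigma^{(r,p)} for sigma in S_m (one-line, values 1..m):
   site i (1<=i<=m) gets chip sigma_i if sigma_i < r, else sigma_i + 1;
   chip r is put on site p.  Chip c <> r thus sits at the (1-based) position
   in sigma of c (if c < r) or of c-1 (if c > r). *)
Definition sigma_rp (sigma : seq nat) (r p : nat) : config :=
  fun c => if c == r then p%:Z%R
           else ((index (if (c < r)%N then c else c.-1) sigma).+1)%:Z%R.

Definition p_resultant (n p : nat) (pi : seq nat) : Prop :=
  exists pos, in_S n.-1 p pos /\ topples_to n pos pi.

Definition ltr_max (s : seq nat) (x : nat) : Prop :=
  x \in s /\ all (fun y => (y <= x)%N) (take (index x s) s).

Definition rtl_min (s : seq nat) (x : nat) : Prop :=
  x \in s /\ all (fun y => (x <= y)%N) (drop (index x s).+1 s).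

Definition pi_left (n p : nat) (pi : seq nat) := take (n - p) pi.
Definition pi_right (n p : nat) (pi : seq nat) := drop (n - p) pi.

(* Main.v *)
(** Put [q = n - p].  Launch [p] "horizontal" lines, the [k]-th from site [p - k],
    and [q] "vertical" lines, the [j]-th from site [p + j]; every line carries the
    chip found at its start (site [p] starts two lines).  Line [k] meets line [j]
    exactly once, and every toppling of every run is such a crossing: the larger
    chip continues on the horizontal line, moving right, the smaller one on the
    vertical line, moving left.  Hence the outcome is that of a [p * q] grid of
    comparators, whatever the order of the topplings: the left part of [pi] is
    read on the vertical lines and the right part on the horizontal ones.  The
    records at [r] propagate along the grid by induction; conversely a chip [r]
    that is a record of [pi] is brought to site [p] by a single exchange of two
    entries of [pi], which leads to a grid given in closed form. *)
Require Import Defs.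
From mathcomp Require Import all_boot all_order all_algebra.
From mathcomp Require Import zify.
Set Implicit Arguments. Unset Strict Implicit. Unset Printing Implicit Defensive.

(** * The grid of comparators and its partial runs *)

(** [H k j] is the chip on horizontal line [k] just before column [j], and [V k j] the chip on
    vertical line [j] just before row [k]; [H k q] and [V p j] leave the grid. *)
Definition crossing_grid (p q : nat) (H V : nat -> nat -> nat) : Prop :=
  forall k j, k < p -> j < q ->
    H k j.+1 = maxn (H k j) (V k j) /\ V k.+1 j = minn (H k j) (V k j).

(* The crossings already performed form a Young diagram with row lengths [f] and
   column lengths [g]. *)
Definition frontier (p q : nat) (f g : nat -> nat) : Prop :=
  [/\ forall k, k < p -> f k <= q, forall j, j < q -> g j <= p
    & forall k j, k < p -> j < q -> (j < f k) = (k < g j)].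

(** A line moves one site per crossing, so its site is its start shifted by the crossings made. On a
    frontier the subtractions never truncate, since [k < p] and [g j <= p]. *)
Definition on_frontier (p q : nat) (H V : nat -> nat -> nat)
    (f g : nat -> nat) (pos : config) : Prop :=
  forall c, chip (p + q) c ->
    (exists k, [/\ k < p, c = H k (f k) & pos c = Posz (p + f k - k)]) \/
    (exists j, [/\ j < q, c = V (g j) j & pos c = Posz (p + j - g j)]).

Definition upd (f : nat -> nat) (i v : nat) : nat -> nat :=
  fun x => if x == i then v else f x.

Lemma mem_chips (n c : nat) : (c \in iota 1 n) = chip n c.
Proof. by rewrite mem_iota /chip; lia. Qed.

(** A list of [n] entries covering [n] labels has no room for repetitions. *)
Lemma perm_chips (n : nat) (s : seq nat) :
  size s = n -> (forall c, chip n c -> c \in s) -> perm_eq s (iota 1 n).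
Proof.
move=> sz cov.
have sub : {subset iota 1 n <= s} by move=> c; rewrite mem_chips; apply: cov.
have le : size s <= size (iota 1 n) by rewrite size_iota sz.
have us := leq_size_uniq (iota_uniq 1 n) sub le.
have [_ eqi] := uniq_min_size (iota_uniq 1 n) sub le.
by rewrite perm_sym; apply: uniq_perm; rewrite ?iota_uniq.
Qed.

Lemma uniq_mkseq_inj (h : nat -> nat) (p x y : nat) :
  uniq (mkseq h p) -> x < p -> y < p -> h x = h y -> x = y.
Proof. by move/mkseq_uniqP => inj xp yp; apply: inj. Qed.

Lemma perm_lines (p q : nat) (h v : nat -> nat) :
  (forall c, chip (p + q) c ->
     (exists2 k, k < p & c = h k) \/ (exists2 j, j < q & c = v j)) ->
  perm_eq (mkseq h p ++ mkseq v q) (iota 1 (p + q)).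
Proof.
move=> cov; apply: perm_chips; first by rewrite size_cat !size_mkseq.
move=> c /cov [[k kp ->]|[j jq ->]]; rewrite mem_cat.
- by rewrite map_f // mem_iota.
- by rewrite orbC map_f // mem_iota.
Qed.

Lemma lines_facts (p q : nat) (h v : nat -> nat) :
  perm_eq (mkseq h p ++ mkseq v q) (iota 1 (p + q)) ->
  [/\ forall k, k < p -> chip (p + q) (h k), forall j, j < q -> chip (p + q) (v j),
      forall k j, k < p -> j < q -> h k <> v j,
      forall k k', k < p -> k' < p -> h k = h k' -> k = k'
    & forall j j', j < q -> j' < q -> v j = v j' -> j = j'].
Proof.
move=> pe; have := perm_uniq pe; rewrite iota_uniq cat_uniq => /and3P[uh hv uv].
have hin k : k < p -> h k \in mkseq h p by move=> kp; rewrite map_f // mem_iota.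
have vin j : j < q -> v j \in mkseq v q by move=> jq; rewrite map_f // mem_iota.
split=> [k kp|j jq|k j kp jq e|k k'|j j'].
- by rewrite -mem_chips -(perm_mem pe) mem_cat hin.
- by rewrite -mem_chips -(perm_mem pe) mem_cat vin ?orbT.
- by move/hasP: hv; apply; exists (v j); rewrite ?vin //= -e hin.
- exact: uniq_mkseq_inj.
- exact: uniq_mkseq_inj.
Qed.

Lemma on_frontier_perm (p q : nat) H V f g pos :
  on_frontier p q H V f g pos ->
  perm_eq (mkseq (fun k => H k (f k)) p ++ mkseq (fun j => V (g j) j) q)
          (iota 1 (p + q)).
Proof.
move=> on; apply: perm_lines => c /on [[k [kp -> _]]|[j [jq -> _]]].
- by left; exists k.
- by right; exists j.
Qed.

(** [on_frontier] only assigns some line to each chip. There are as many lines as chips, so distinct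
    lines carry distinct chips and the line of a chip is unique. *)
Lemma on_frontier_pos (p q : nat) H V f g pos :
  on_frontier p q H V f g pos ->
  (forall k, k < p -> pos (H k (f k)) = Posz (p + f k - k)) /\
  (forall j, j < q -> pos (V (g j) j) = Posz (p + j - g j)).
Proof.
move=> on; have [ch cv hv ih iv] := lines_facts (on_frontier_perm on).
split=> [k kp|j jq].
- case: (on _ (ch _ kp)) => [[k' [k'p e ->]]|[j [jq e _]]]; last by case: (hv k j).
  by rewrite (ih _ _ kp k'p e).
- case: (on _ (cv _ jq)) => [[k [kp e _]]|[j' [j'q e ->]]]; first by case: (hv k j).
  by rewrite (iv _ _ jq j'q e).
Qed.

(** * Topplings as boxes added to the diagram *)

Lemma frontier_antitone (p q : nat) f g k k' :
  frontier p q f g -> k < k' -> k' < p -> f k' <= f k.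
Proof.
case=> fq _ fg kk' k'p; rewrite leqNgt; apply/negP => lt.
have := fq _ k'p => le; have jq : f k < q by lia.
by have := fg _ _ k'p jq; rewrite lt; have := fg k (f k) (ltn_trans kk' k'p) jq; lia.
Qed.

Lemma frontier_antitone_col (p q : nat) f g j j' :
  frontier p q f g -> j < j' -> j' < q -> g j' <= g j.
Proof.
case=> fq gp fg jj' j'q; rewrite leqNgt; apply/negP => lt.
have := gp _ j'q => le; have kp : g j < p by lia.
by have := fg _ _ kp j'q; rewrite lt; have := fg (g j) j kp (ltn_trans jj' j'q); lia.
Qed.

Lemma frontier_upd (p q : nat) f g k j :
  frontier p q f g -> k < p -> j < q -> f k = j -> g j = k ->
  frontier p q (upd f k j.+1) (upd g j k.+1).
Proof.
move=> [fq gp fg] kp jq fk gj; split=> [k0|j0|k0 j0]; rewrite /upd.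
- by case: eqP => // _ /fq.
- by case: eqP => // _ /gp.
- move=> k0p j0q; have := fg _ _ k0p j0q.
  case: (eqVneq k0 k) => [->|]; case: (eqVneq j0 j) => [->|]; lia.
Qed.

Lemma on_frontier_upd (p q : nat) H V f g k j (pos pos' : config) a b :
  crossing_grid p q H V -> frontier p q f g -> on_frontier p q H V f g pos ->
  k < p -> j < q -> f k = j -> g j = k ->
  a = minn (H k j) (V k j) -> b = maxn (H k j) (V k j) -> pos a = pos b ->
  (forall c, pos' c = (if c == a then pos a - 1
                       else if c == b then pos b + 1 else pos c)%R) ->
  a < b ->
  on_frontier p q H V (upd f k j.+1) (upd g j k.+1) pos'.
Proof.
move=> grid fr on kp jq fk gj ea eb eab ep ab c cc.
have [eH eV] := grid _ _ kp jq; have [pH pV] := on_frontier_pos on.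
have pa : pos a = Posz (p + j - k).
  have := pH _ kp; have := pV _ jq; rewrite fk gj => p1 p2.
  by rewrite ea /minn; case: ifP.
rewrite ep; have [->|ca] := eqVneq c a.
  right; exists j; rewrite /upd eqxx eV pa; split=> //; lia.
have [->|cb] := eqVneq c b.
  left; exists k; rewrite /upd eqxx eH -eab pa; split=> //; lia.
case: (on _ cc) => [[k0 [k0p e p0]]|[j0 [j0q e p0]]].
- left; exists k0; have nk : k0 != k by apply/eqP => ek; move: e ca cb; rewrite ek fk ea eb; lia.
  by rewrite /upd (negbTE nk).
- right; exists j0; have nj : j0 != j by apply/eqP => ek; move: e ca cb; rewrite ek gj ea eb; lia.
  by rewrite /upd (negbTE nj).
Qed.

(** Two chips on one site lie on lines of different kinds that are about to cross at a corner of the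
    diagram, so the toppling is one comparator of the grid. *)
Lemma topple_step_frontier (p q : nat) H V f g (pos pos' : config) :
  crossing_grid p q H V -> frontier p q f g -> on_frontier p q H V f g pos ->
  topple_step (p + q) pos pos' ->
  exists f' g', frontier p q f' g' /\ on_frontier p q H V f' g' pos'.
Proof.
move=> grid fr on [a [b [a1 ab bn eab ep]]].
have ca : chip (p + q) a by rewrite /chip; lia.
have cb : chip (p + q) b by rewrite /chip; lia.
have [fq gp fg] := fr.
suff [k [j [kp jq fk gj [ea eb]]]] : exists k j, [/\ k < p, j < q, f k = j, g j = k
    & a = minn (H k j) (V k j) /\ b = maxn (H k j) (V k j)].
  exists (upd f k j.+1), (upd g j k.+1); split; first exact: frontier_upd.
  exact: (on_frontier_upd grid fr on kp jq fk gj ea eb).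
have mixed k j x y : k < p -> j < q -> x = H k (f k) -> y = V (g j) j ->
    Posz (p + f k - k) = Posz (p + j - g j) ->
    [/\ f k = j, g j = k, x = H k j & y = V k j].
  (* Equal sites mean [f k + g j = k + j]. By conjugacy [j < f k] and [k < g j] hold together or
     fail together, so [f k = j] and [g j = k]. *)
  move=> kp jq ex ey e; have := fg _ _ kp jq; have := gp _ jq => h1 h2.
  have fk : f k = j by lia.
  have gj : g j = k by lia.
  by rewrite ex ey fk gj.
move: eab; case: (on _ ca) => [[k [kp e ->]]|[j [jq e ->]]];
  case: (on _ cb) => [[k' [k'p e' ->]]|[j' [j'q e' ->]]] eab.
(* Row lengths weakly decrease, so the sites [p + f k - k] strictly decrease in [k]: two horizontal
   lines never share a site. *)
- case: (ltngtP k k') => [kk'|kk'|kk']; last by move: e'; rewrite -kk' -e; lia.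
  + by have := frontier_antitone fr kk' k'p; lia.
  + by have := frontier_antitone fr kk' kp; lia.
- have [fk gj ex ey] := mixed _ _ _ _ kp j'q e e' eab.
  by exists k, j'; split=> //; lia.
- have [fk gj ex ey] := mixed _ _ _ _ k'p jq e' e (esym eab).
  by exists k', j; split=> //; lia.
- have := gp _ jq; have := gp _ j'q.
  case: (ltngtP j j') => [jj'|jj'|jj']; last by move: e'; rewrite -jj' -e; lia.
  + by have := frontier_antitone_col fr jj' j'q; lia.
  + by have := frontier_antitone_col fr jj' jq; lia.
Qed.

Lemma topples_rt_frontier (p q : nat) H V f g (pos pos' : config) :
  crossing_grid p q H V -> frontier p q f g -> on_frontier p q H V f g pos ->
  topples_rt (p + q) pos pos' ->
  exists f' g', frontier p q f' g' /\ on_frontier p q H V f' g' pos'.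
Proof.
move=> grid fr on rt; elim: rt f g fr on => [?|? ? ? st _ IH] f g fr on; first by exists f, g.
by have [f' [g' [fr' on']]] := topple_step_frontier grid fr on st; apply: IH on'.
Qed.

(** * Runs to completion and the final reading *)

Lemma frontier_full_or_corner (p q : nat) f g :
  frontier p q f g ->
  ((forall k, k < p -> f k = q) /\ (forall j, j < q -> g j = p)) \/
  (exists k j, [/\ k < p, j < q, f k = j & g j = k]).
Proof.
move=> [fq gp fg].
have [ex|nex] := boolP (has (fun k => f k < q) (iota 0 p)).
  right; have ex' : exists k, (k < p) && (f k < q).
    by move/hasP: ex => [k]; rewrite mem_iota => kp fk; exists k; lia.
  (* The first unfinished row has a corner at its end: all rows above it are full, so column [f k]
     has length exactly [k]. *)
  case: (ex_minnP ex') => k /andP[kp fk] kmin; exists k, (f k); split=> //.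
  have := fg _ _ kp fk; have := gp _ fk => h1 h2.
  have [//|lt] : g (f k) = k \/ g (f k) < k by lia.
  have := fg _ _ (ltn_trans lt kp) fk; have := kmin (g (f k)); have := fq _ (ltn_trans lt kp); lia.
left; have full k : k < p -> f k = q.
  move=> kp; have := fq _ kp; have := hasPn nex k; rewrite mem_iota kp => /(_ isT); lia.
split=> // j jq; have := gp _ jq; case: (ltngtP (g j) p) => // lt _.
by have := fg _ _ lt jq; rewrite full //; lia.
Qed.

Lemma corner_topple (p q : nat) H V f g k j (pos : config) :
  crossing_grid p q H V -> frontier p q f g -> on_frontier p q H V f g pos ->
  k < p -> j < q -> f k = j -> g j = k ->
  exists2 pos', topple_step (p + q) pos pos' &
    on_frontier p q H V (upd f k j.+1) (upd g j k.+1) pos'.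
Proof.
move=> grid fr on kp jq fk gj.
have [ch cv hv _ _] := lines_facts (on_frontier_perm on).
have [pH pV] := on_frontier_pos on.
have := (ch _ kp, cv _ jq, hv _ _ kp jq, pH _ kp, pV _ jq).
rewrite fk gj => -[[[[cH cV] neq] eH] eV].
set a := minn (H k j) (V k j); set b := maxn (H k j) (V k j).
have eab : pos a = pos b by rewrite /a /b /minn /maxn; case: ifP; rewrite eH eV.
have ab : a < b by rewrite /a /b; lia.
pose pos' c := (if c == a then pos a - 1 else if c == b then pos b + 1 else pos c)%R.
exists pos'; last exact: (on_frontier_upd grid fr on kp jq fk gj (erefl a) (erefl b)).
by exists a, b; split=> //; move: cH cV; rewrite /chip /a /b; lia.
Qed.

Lemma on_frontier_stable (p q : nat) H V f g (pos : config) :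
  crossing_grid p q H V -> frontier p q f g -> on_frontier p q H V f g pos ->
  stable (p + q) pos ->
  (forall k, k < p -> f k = q) /\ (forall j, j < q -> g j = p).
Proof.
move=> grid fr on st.
case: (frontier_full_or_corner fr) => // -[k [j [kp jq fk gj]]].
have [pos' [a [b [a1 ab bn eab _]]] _] := corner_topple grid fr on kp jq fk gj.
have := st a b; rewrite /chip eab eqxx; lia.
Qed.

Lemma sum_upd (p k v : nat) (f : nat -> nat) :
  k < p -> \sum_(i < p) upd f k v i + f k = \sum_(i < p) f i + v.
Proof.
move=> kp; rewrite (bigD1 (Ordinal kp)) //= [in RHS](bigD1 (Ordinal kp)) //=.
rewrite {1}/upd eqxx (eq_bigr (fun i : 'I_p => f i)); first by lia.
by move=> i; rewrite /upd -val_eqE /= => /negbTE ->.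
Qed.

Lemma topples_to_full (p q : nat) H V f g (pos : config) :
  crossing_grid p q H V -> frontier p q f g -> on_frontier p q H V f g pos ->
  exists2 pos', topples_rt (p + q) pos pos' &
    on_frontier p q H V (fun=> q) (fun=> p) pos'.
Proof.
(* The measure is the number of crossings not yet performed. *)
move=> grid; have [N] := ubnP (p * q - \sum_(i < p) f i).
elim: N f g pos => // N IH f g pos ltN fr on.
case: (frontier_full_or_corner fr) => [[ff gf]|[k [j [kp jq fk gj]]]].
  exists pos; first by constructor.
  move=> c /on [[k [kp]]|[j [jq]]].
  - by rewrite ff // => ? ?; left; exists k.
  - by rewrite gf // => ? ?; right; exists j.
have [pos' st on'] := corner_topple grid fr on kp jq fk gj.
have fr' := frontier_upd fr kp jq fk gj.
have [|pos'' rt full] := IH _ _ _ _ fr' on'; last first.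
  by exists pos'' => //; apply: topples_trans st rt.
have := sum_upd j.+1 f kp; have [fq' _ _] := fr'.
have : \sum_(i < p) upd f k j.+1 i <= \sum_(i < p) q by apply: leq_sum => i _; apply: fq'.
rewrite sum_nat_const card_ord; lia.
Qed.

(** At the end vertical line [j] is at site [j] and horizontal line [k] at site [p + q - k]; hence
    the reversal, and site [q] is empty. *)
Definition outcome (p q : nat) (H V : nat -> nat -> nat) : seq nat :=
  mkseq (V p) q ++ rev (mkseq (H^~ q) p).

Lemma nth_outcome (p q : nat) H V i :
  i < p + q -> nth 0 (outcome p q H V) i =
               if i < q then V p i else H (p + q - 1 - i) q.
Proof.
move=> ipq; rewrite nth_cat size_mkseq; case: ltnP => iq; first by rewrite nth_mkseq.
rewrite nth_rev size_mkseq ?nth_mkseq; try lia; congr H; lia.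
Qed.

Lemma size_outcome (p q : nat) H V : size (outcome p q H V) = p + q.
Proof. by rewrite size_cat size_rev !size_mkseq addnC. Qed.

Lemma reading_full (p q : nat) H V (pos : config) :
  on_frontier p q H V (fun=> q) (fun=> p) pos ->
  reading (p + q) pos = outcome p q H V.
Proof.
move=> on; have [pH pV] := on_frontier_pos on.
have pe : perm_eq (iota 1 (p + q)) (outcome p q H V).
  rewrite perm_sym /outcome perm_catC; apply: perm_trans (on_frontier_perm on).
  by rewrite perm_cat2r perm_rev.
set le := fun a b => (pos a <= pos b)%R.
(* Distinct chips have distinct sites, so there are no ties and sorting [outcome] gives the same
   list as sorting the labels. *)
have st : {in iota 1 (p + q) &, antisymmetric le}.
  move=> a b; rewrite !mem_chips => ca cb /andP[l1 l2].
  have {l1 l2} : pos a = pos b by move: l1 l2; rewrite /le; lia.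
  case: (on _ ca) => [[k [kp -> ->]]|[j [jq -> ->]]];
    case: (on _ cb) => [[k' [k'p -> ->]]|[j' [j'q -> ->]]] e.
  - by congr H; lia.
  - lia.
  - lia.
  - by congr V; lia.
have tot : {in iota 1 (p + q) &, total le} by move=> a b _ _; rewrite /le; lia.
have tr : transitive le by move=> a b c; rewrite /le; lia.
have -> : reading (p + q) pos = sort le (outcome p q H V).
  exact/(perm_sort_inP _ tot (in3W tr) st).
apply: sorted_sort => //; apply/(sortedP 0) => i; rewrite size_outcome => ipq.
rewrite !nth_outcome /le; try lia.
case: ltnP => h2; case: ltnP => h1; rewrite ?pH ?pH ?pV ?pV; lia.
Qed.

Lemma full_stable (p q : nat) H V (pos : config) :
  on_frontier p q H V (fun=> q) (fun=> p) pos -> stable (p + q) pos.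
Proof.
move=> on a b ca cb /eqP nab; apply/eqP => e; apply: nab; move: e.
case: (on _ ca) => [[k [kp -> ->]]|[j [jq -> ->]]];
  case: (on _ cb) => [[k' [k'p -> ->]]|[j' [j'q -> ->]]] e.
- by congr H; lia.
- lia.
- lia.
- by congr V; lia.
Qed.

(** Every stable end of a run has a full diagram, and a run filling the diagram exists: confluence,
    with the result computed. *)
Lemma topples_to_outcome (p q : nat) H V (pos : config) pi :
  crossing_grid p q H V -> on_frontier p q H V (fun=> 0) (fun=> 0) pos ->
  topples_to (p + q) pos pi <-> pi = outcome p q H V.
Proof.
move=> grid on; have fr : frontier p q (fun=> 0) (fun=> 0) by [].
split=> [[pos' [rt st <-]]|->].
  have [f [g [fr' on']]] := topples_rt_frontier grid fr on rt.
  have [ff gf] := on_frontier_stable grid fr' on' st.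
  apply: reading_full => c /on' [[k [kp]]|[j [jq]]].
  - by rewrite ff // => ? ?; left; exists k.
  - by rewrite gf // => ? ?; right; exists j.
have [pos' rt full] := topples_to_full grid fr on.
by exists pos'; split; [| exact: full_stable full | exact: reading_full].
Qed.

(** * Grids built from their boundary, monotonicity and records *)

Fixpoint carry (v : nat -> nat) (x j : nat) : nat :=
  if j is i.+1 then maxn (carry v x i) (v i) else x.

(** [carry] is the running maximum along a row; the minima it leaves behind form the input of the
    next row. *)
Fixpoint gridV (h v : nat -> nat) (k : nat) : nat -> nat :=
  if k is i.+1 then fun j => minn (carry (gridV h v i) (h i) j) (gridV h v i j)
  else v.

Definition gridH (h v : nat -> nat) (k : nat) : nat -> nat :=
  carry (gridV h v k) (h k).

Lemma crossing_grid_table p q h v : crossing_grid p q (gridH h v) (gridV h v).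
Proof. by []. Qed.

Lemma grid_row_mono p q H V k j j' :
  crossing_grid p q H V -> k < p -> j <= j' -> j' <= q -> H k j <= H k j'.
Proof.
move=> grid kp; elim: j' => [|j' IH]; first by case: j.
rewrite leq_eqVlt => /orP[/eqP->//|jj'] j'q.
by have [-> _] := grid _ _ kp j'q; have := IH jj' (ltnW j'q); lia.
Qed.

Lemma grid_col_mono p q H V k k' j :
  crossing_grid p q H V -> j < q -> k <= k' -> k' <= p -> V k' j <= V k j.
Proof.
move=> grid jq; elim: k' => [|k' IH]; first by case: k.
rewrite leq_eqVlt => /orP[/eqP->//|kk'] k'p.
by have [_ ->] := grid _ _ k'p jq; have := IH kk' (ltnW k'p); lia.
Qed.

(* The horizontal and vertical lines through the crossing [(k, j)] are sorted
   there, and afterwards the former only increases and the latter decreases. *)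
Lemma outcome_separated p q H V k j :
  crossing_grid p q H V -> k < p -> j < q -> V p j <= H k q.
Proof.
move=> grid kp jq; have [eH eV] := grid _ _ kp jq.
have := grid_row_mono grid kp jq (leqnn q).
have := grid_col_mono grid jq kp (leqnn p); lia.
Qed.

(** Induction on rows, starting with [r] in column [0] at most. If [r] comes down its column, the
    entries to its left only decrease. If it comes along row [k], what that row left in column [j']
    is at most what it carried on, hence at most [r]. *)
Lemma vertical_record p q H V r :
  crossing_grid p q H V -> (forall j, 0 < j -> j < q -> V 0 j <> r) ->
  forall k j j', k <= p -> j < q -> V k j = r -> j' < j -> V k j' <= r.
Proof.
move=> grid base; elim=> [|k IH] j j' kp jq ej jj'; first by case: (base j); lia.
have j'q := ltn_trans jj' jq.
have [_ eV] := grid _ _ kp jq; have [eH' eV'] := grid _ _ kp j'q.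
case: (leqP (V k j) (H k j)) => [le|lt].
  by have := IH j j' (ltnW kp) jq _ jj'; lia.
by have := grid_row_mono grid kp jj' (ltnW jq); lia.
Qed.

(** The dual induction on columns: initially [r] is in row [0] at most, and a chip [r] arriving
    along a column has left larger chips on the rows it crossed. *)
Lemma horizontal_record p q H V r :
  crossing_grid p q H V -> (forall k, 0 < k -> k < p -> H k 0 <> r) ->
  forall j k k', j <= q -> k < p -> H k j = r -> k' < k -> r <= H k' j.
Proof.
move=> grid base; elim=> [|j IH] k k' jq kp ek kk'; first by case: (base k); lia.
have k'p := ltn_trans kk' kp.
have [eH _] := grid _ _ kp jq; have [eH' eV'] := grid _ _ k'p jq.
case: (leqP (V k j) (H k j)) => [le|lt].
  by have := IH k k' (ltnW jq) kp _ kk'; lia.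
by have := grid_col_mono grid jq kk' (ltnW kp); lia.
Qed.

(** * Starting configurations as data on the lines *)

Definition layout (p q : nat) (pos : config) (h v : nat -> nat) : Prop :=
  forall c, chip (p + q) c ->
    (exists k, [/\ k < p, c = h k & pos c = Posz (p - k)]) \/
    (exists j, [/\ j < q, c = v j & pos c = Posz (p + j)]).

Lemma layout_on_frontier p q pos H V :
  layout p q pos (H^~ 0) (V 0) -> on_frontier p q H V (fun=> 0) (fun=> 0) pos.
Proof.
move=> lay c /lay [[k [kp ec ->]]|[j [jq ec ->]]].
- by left; exists k; rewrite addn0.
- by right; exists j; rewrite subn0.
Qed.

Lemma layout_topples_to p q pos H V pi :
  crossing_grid p q H V -> layout p q pos (H^~ 0) (V 0) ->
  topples_to (p + q) pos pi <-> pi = outcome p q H V.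
Proof. by move=> grid /layout_on_frontier; apply: topples_to_outcome. Qed.

(** Of the two chips at site [p], the first listed starts horizontal line [0] and the second
    vertical line [0]: the index [j == 0] is [1] there and [0] at the other sites, which hold one
    chip. *)
Lemma in_S_layout p q pos :
  0 < p -> 0 < q -> in_S (p + q).-1 p pos ->
  layout p q pos
    (fun k => nth 0 [seq c <- iota 1 (p + q) | pos c == Posz (p - k)] 0)
    (fun j => nth 0 [seq c <- iota 1 (p + q) | pos c == Posz (p + j)] (j == 0)).
Proof.
move=> p0 q0 []; rewrite prednK ?addn_gt0 ?p0 // => range cnt c cc.
have [lo hi] := range c cc.
have [i ei] : exists i : nat, pos c = Posz i by exists `|pos c|%N; lia.
have ibd : 0 < i <= (p + q).-1 by lia.
have := cnt i ibd; rewrite -size_filter.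
have : c \in [seq c <- iota 1 (p + q) | pos c == Posz i].
  by rewrite mem_filter ei eqxx mem_chips.
case: (ltngtP i p) => ip cin sz.
- left; exists (p - i); rewrite (_ : p - (p - i) = i); last by lia.
  split=> //; first by lia.
  by case: filter cin sz => [|x []] //=; rewrite inE => /eqP.
- right; exists (i - p); rewrite (_ : p + (i - p) = i); last by lia.
  rewrite (_ : (i - p == 0) = false); last by lia.
  split=> //; first by lia.
  by case: filter cin sz => [|x []] //=; rewrite inE => /eqP.
- rewrite ip in ei cin sz.
  move: cin sz; case E: filter => [|x [|y []]] //=; rewrite !inE => /orP[]/eqP ec _.
  + by left; exists 0; rewrite subn0 E.
  + by right; exists 0; rewrite addn0 E.
Qed.

(** The relabelling that makes room for chip [r]; [contract] undoes it on the other chips. *)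
Definition expand (r s : nat) : nat := if s < r then s else s.+1.
Definition contract (r c : nat) : nat := if c < r then c else c.-1.

Lemma expand_inj r : injective (expand r).
Proof. by move=> x y; rewrite /expand; case: (ltnP x r); case: (ltnP y r); lia. Qed.

Lemma contractK r c : 0 < c -> c != r -> expand r (contract r c) = c.
Proof. by move=> c0 cr; rewrite /expand /contract; case: (ltnP c r) => h /=; case: ltnP; lia. Qed.

Lemma sigma_rpE sigma r p c :
  0 < c -> c != r ->
  sigma_rp sigma r p c = Posz (index c (map (expand r) sigma)).+1.
Proof.
move=> c0 cr; rewrite /sigma_rp (negbTE cr).
by rewrite -[in RHS](contractK c0 cr) index_map //; apply: expand_inj.
Qed.

Lemma perm_expand n r :
  0 < r <= n -> perm_eq (r :: map (expand r) (iota 1 (n - 1))) (iota 1 n).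
Proof.
move=> rn; apply: perm_chips => [|c cc]; first by rewrite /= size_map size_iota; lia.
rewrite inE; case: eqVneq => //= cr.
have c0 : 0 < c by case/andP: cc.
rewrite -(contractK c0 cr) map_f // mem_iota.
by move: cc; rewrite /chip /contract; case: (ltnP c r); lia.
Qed.

(** Chip [r] is chosen to start vertical line [0]; it then starts in no other column and in no row,
    as both record inductions require. *)
Lemma sigma_layout p q r sigma :
  0 < p -> 0 < q -> 0 < r <= p + q -> perm_eq sigma (iota 1 (p + q - 1)) ->
  exists h v, v 0 = r /\ layout p q (sigma_rp sigma r p) h v.
Proof.
move=> p0 q0 rn ps; pose w := map (expand r) sigma.
have pw : perm_eq (r :: w) (iota 1 (p + q)).
  by apply: perm_trans (perm_expand rn); rewrite perm_cons perm_map.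
have sw : (size w).+1 = p + q by have /= := perm_size pw; rewrite size_iota.
(* Entry [i] of [w] sits at site [i + 1], while the lines start at [p - k] and [p + j]. *)
exists (fun k => nth 0 w (p - 1 - k)), (fun j => if j == 0 then r else nth 0 w (p + j - 1)).
split=> // c cc; have := cc; rewrite -mem_chips -(perm_mem pw) inE.
have [-> _|cr /= cw] := eqVneq c r.
  by right; exists 0; rewrite /sigma_rp !eqxx addn0.
rewrite sigma_rpE //; last by case/andP: cc.
have := nth_index 0 cw; have : index c w < size w by rewrite index_mem.
rewrite -/w; set i := index c w => iw <-.
case: (ltnP i p) => ip.
- left; exists (p - 1 - i); split; [lia|congr nth; lia|lia].
- right; exists (i + 1 - p); split; [lia| |lia].
  have -> : (i + 1 - p == 0) = false by lia.
  congr nth; lia.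
Qed.

Lemma layout_sigma p q r h v :
  0 < p -> 0 < q -> 0 < r <= p + q -> r = h 0 \/ r = v 0 ->
  (forall c, chip (p + q) c ->
     (exists2 k, k < p & c = h k) \/ (exists2 j, j < q & c = v j)) ->
  exists sigma, perm_eq sigma (iota 1 (p + q - 1)) /\
                layout p q (sigma_rp sigma r p) h v.
Proof.
move=> p0 q0 rn rhv cov.
(* [x] is the companion of [r] at site [p], and [u i] is the chip other than [r] at site [i + 1]. *)
pose x := if r == h 0 then v 0 else h 0.
pose u i := if i + 1 < p then h (p - 1 - i)
            else if i + 1 == p then x else v (i + 1 - p).
pose w := mkseq u (p + q - 1).
have uw i : i < p + q - 1 -> u i \in w by move=> ipq; rewrite map_f // mem_iota.
have pw : perm_eq (r :: w) (iota 1 (p + q)).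
  apply: perm_chips; first by rewrite /= size_mkseq; lia.
  have xw : x \in w by rewrite (_ : x = u (p - 1)) ?uw // /u; [lia|do 2 (case: ifP; try lia)].
  have hv0 c : c = h 0 \/ c = v 0 -> c \in r :: w.
    rewrite inE; have [->//|cr] := eqVneq c r => chv /=; rewrite (_ : c = x) // /x.
    by case: eqP; move: rhv chv cr; lia.
  move=> c /cov [[[|k] kp ec]|[[|j] jq ec]]; [by apply: hv0; left| |by apply: hv0; right|].
  - rewrite inE orbC (_ : c = u (p - 1 - k.+1)) ?uw //; first lia.
    rewrite ec /u ifT; last lia.
    congr h; lia.
  - rewrite inE orbC (_ : c = u (p + j)) ?uw //; first lia.
    rewrite ec /u !ifF; try lia.
    congr v; lia.
have rw : r \notin w by have := perm_uniq pw; rewrite iota_uniq /= => /andP[].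
have ew : map (expand r) (map (contract r) w) = w.
  rewrite -map_comp map_id_in // => c cw /=; apply: contractK.
  - have : c \in iota 1 (p + q) by rewrite -(perm_mem pw) inE cw orbT.
    by rewrite mem_chips => /andP[].
  - by apply: contraNneq rw => <-.
exists (map (contract r) w); split.
  apply: (perm_map_inj (@expand_inj r)); rewrite ew -(perm_cons r).
  by apply: perm_trans pw _; rewrite perm_sym perm_expand.
move=> c cc; have := cc; rewrite -mem_chips -(perm_mem pw) inE.
have [-> _|cr /= cw] := eqVneq c r.
  by rewrite /sigma_rp eqxx; case: rhv => ->; [left|right]; exists 0; rewrite ?subn0 ?addn0.
rewrite sigma_rpE // ?ew; last by case/andP: cc.
have := nth_index 0 cw; have : index c w < p + q - 1.
  by rewrite -[X in _ < X](size_mkseq u) index_mem.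
set i := index c w => iw.
rewrite nth_mkseq // => <-; rewrite /u; case: ltnP => ip.
  by left; exists (p - 1 - i); split=> //; lia.
case: eqP => eip; last by right; exists (i + 1 - p); split=> //; lia.
rewrite /x; case: eqP => _; [right|left]; exists 0; split=> //; lia.
Qed.

(** * Separation and records in terms of positions *)

Lemma perm_separated n q pi :
  perm_eq pi (iota 1 n) -> q <= n ->
  (forall i j, i < q -> q <= j -> j < n -> nth 0 pi i <= nth 0 pi j) ->
  forall i, i < n -> (nth 0 pi i <= q) = (i < q).
Proof.
move=> pp qn sep.
have sz : size pi = n by rewrite (perm_size pp) size_iota.
(* By separation, sorting the two halves one by one already sorts [pi]; the first half therefore
   consists of [1..q]. *)
have spl : iota 1 n = sort leq (take q pi) ++ sort leq (drop q pi).
  apply: (sorted_eq leq_trans anti_leq); first exact: iota_sorted.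
    rewrite sorted_pairwise ?pairwise_cat -?sorted_pairwise; try exact: leq_trans.
    rewrite !sort_sorted ?andbT; try exact: leq_total.
    apply/allrelP => a b; rewrite !mem_sort => /(nthP 0) [i]; rewrite size_takel ?sz // => iq <-.
    move/(nthP 0) => [j]; rewrite size_drop sz => jn <-.
    rewrite nth_take // nth_drop; apply: sep => //; lia.
  rewrite perm_sym; apply: perm_trans pp.
  by rewrite -{3}(cat_take_drop q pi) perm_cat // perm_sort.
have st : perm_eq (take q pi) (iota 1 q).
  rewrite -(perm_sort leq).
  have -> : iota 1 q = take q (iota 1 n) by rewrite take_iota; congr iota; lia.
  by rewrite spl take_size_cat // size_sort size_takel ?sz.
move=> i iN; have ui : uniq pi by rewrite (perm_uniq pp) iota_uniq.
have : nth 0 pi i \in iota 1 n by rewrite -(perm_mem pp) mem_nth ?sz.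
rewrite mem_chips => /andP[lo _].
have := perm_mem st (nth 0 pi i); rewrite mem_chips /chip lo /= => <-.
by rewrite in_take ?sz ?index_uniq ?sz //; rewrite mem_nth ?sz.
Qed.

Lemma ltr_max_take (s : seq nat) q t :
  uniq s -> q <= size s -> t < q ->
  ltr_max (take q s) (nth 0 s t) <-> forall j, j < t -> nth 0 s j <= nth 0 s t.
Proof.
move=> us qs tq; have ts : t < size s := leq_trans tq qs.
have xin : nth 0 s t \in take q s by rewrite in_take ?index_uniq ?mem_nth.
have ix : index (nth 0 s t) (take q s) = t.
  by rewrite -(nth_take 0 tq) index_uniq ?take_uniq // size_takel.
rewrite /ltr_max ix take_takel ?(ltnW tq) //; split=> [[_ /(all_nthP 0) H] j jt|H].
  by have := H j; rewrite size_takel ?(ltnW ts) // nth_take //; apply.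
split=> //; apply/(all_nthP 0) => j; rewrite size_takel ?(ltnW ts) // => jt.
by rewrite nth_take //; apply: H.
Qed.

Lemma rtl_min_drop (s : seq nat) q t :
  uniq s -> q <= t -> t < size s ->
  rtl_min (drop q s) (nth 0 s t) <->
  forall j, t < j -> j < size s -> nth 0 s t <= nth 0 s j.
Proof.
move=> us qt ts; have tq : t - q < size (drop q s) by rewrite size_drop; lia.
have et : nth 0 s t = nth 0 (drop q s) (t - q) by rewrite nth_drop subnKC.
have ix : index (nth 0 s t) (drop q s) = t - q by rewrite et index_uniq ?drop_uniq.
rewrite /rtl_min ix drop_drop (_ : (t - q).+1 + q = t.+1); last lia.
split=> [[_ /(all_nthP 0) H] j tj js|H].
  by have := H (j - t.+1); rewrite size_drop nth_drop subnKC //; apply; lia.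
split; first by rewrite et mem_nth.
apply/(all_nthP 0) => j; rewrite size_drop => jt.
by rewrite nth_drop; apply: H; lia.
Qed.

(** * From grids to permutations and back *)

Lemma layout_record p q pos h v pi t :
  0 < p -> 0 < q -> layout p q pos h v -> topples_to (p + q) pos pi -> t < p + q ->
  nth 0 pi t = v 0 ->
  (t < q -> forall j, j < t -> nth 0 pi j <= nth 0 pi t) /\
  (q <= t -> forall j, t < j -> j < p + q -> nth 0 pi t <= nth 0 pi j).
Proof.
move=> p0 q0 lay tt tn e0; have grid := @crossing_grid_table p q h v.
have /= pe := on_frontier_perm (layout_on_frontier (H := gridH h v) (V := gridV h v) lay).
have [_ _ hv _ iv] := lines_facts pe.
have epi := (layout_topples_to pi grid lay).1 tt.
split=> [tq j jt|qt j tj jn]; move: e0; rewrite epi !nth_outcome; try lia.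
- rewrite tq (ltn_trans jt tq) => e0; rewrite e0.
  apply: (vertical_record grid _ (leqnn p) tq e0 jt) => i i0 iq /= ei.
  by have := iv i 0 iq q0 ei; lia.
(* In the right part a later position is a horizontal line of smaller index. *)
- rewrite ltnNge qt ltnNge (leq_trans qt (ltnW tj)) /= => e0; rewrite e0.
  apply: (horizontal_record grid _ (leqnn q) _ e0) => [i i0 ip /=||]; try lia.
  exact: hv.
Qed.

Lemma topples_to_separated p q pos h v pi i j :
  layout p q pos h v -> topples_to (p + q) pos pi ->
  i < q -> q <= j -> j < p + q -> nth 0 pi i <= nth 0 pi j.
Proof.
move=> lay tt iq qj jn; have grid := @crossing_grid_table p q h v.
rewrite ((layout_topples_to pi grid lay).1 tt) !nth_outcome ?iq; try lia.
by rewrite ltnNge qj /=; apply: (outcome_separated grid); lia.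
Qed.

(** Reduces the converse to exhibiting a grid that ends in [pi] and has [r] at site [p]; the
    crossing relations determine the outcome, so the grid may be given by formulas. *)
Lemma sigma_of_grid p q r H V pi :
  0 < p -> 0 < q -> 0 < r <= p + q -> crossing_grid p q H V ->
  r = H 0 0 \/ r = V 0 0 ->
  (forall c, chip (p + q) c ->
     (exists2 k, k < p & c = H k 0) \/ (exists2 j, j < q & c = V 0 j)) ->
  size pi = p + q ->
  (forall i, i < q -> V p i = nth 0 pi i) ->
  (forall k, k < p -> H k q = nth 0 pi (p + q - 1 - k)) ->
  exists sigma, perm_eq sigma (iota 1 (p + q - 1)) /\
                topples_to (p + q) (sigma_rp sigma r p) pi.
Proof.
move=> p0 q0 rn grid rHV cov sz eV eH.
have [sigma [ps lay]] := layout_sigma (h := H^~ 0) p0 q0 rn rHV cov.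
exists sigma; split=> //; apply/(layout_topples_to _ grid lay).
apply: (@eq_from_nth _ 0); rewrite ?size_outcome // sz => i ipq.
rewrite nth_outcome //; case: ltnP => iq; first by rewrite eV.
by rewrite eH; [congr nth|]; lia.
Qed.

(* Exchanging [nth 0 pi t] with the last entry of [pi]: the only crossing that
   actually swaps anything is the one of the row [0] and the column [t]. *)
Lemma sigma_of_ltr_max p q pi t :
  0 < p -> perm_eq pi (iota 1 (p + q)) ->
  (forall i j, i < q -> q <= j -> j < p + q -> nth 0 pi i <= nth 0 pi j) ->
  t < q -> (forall j, j < t -> nth 0 pi j <= nth 0 pi t) ->
  exists sigma, perm_eq sigma (iota 1 (p + q - 1)) /\
                topples_to (p + q) (sigma_rp sigma (nth 0 pi t) p) pi.
Proof.
move=> p0 pp sep tq rec; have sz : size pi = p + q by rewrite (perm_size pp) size_iota.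
pose E k := nth 0 pi (p + q - 1 - k).
pose H k j := if (k == 0) && (j <= t) then nth 0 pi t else E k.
pose V k j := if (k == 0) && (j == t) then E 0 else nth 0 pi j.
have sepE k j : k < p -> j < q -> nth 0 pi j <= E k by move=> kp jq; apply: sep; lia.
apply: (@sigma_of_grid p q _ H V) => //; first by lia.
- have : nth 0 pi t \in iota 1 (p + q) by rewrite -(perm_mem pp) mem_nth // sz; lia.
  by rewrite mem_chips.
(* [sep] settles the rows below row [0] and the columns from [t] on. Left of [t], row [0] carries
   [nth 0 pi t], and [rec] says that nothing is exchanged. *)
- move=> [|k] j kp jq; rewrite /H /V /=; last by have := sepE _ _ kp jq; lia.
  have := sepE _ _ kp jq; have := sepE _ _ kp tq; case: (ltngtP j t) => jt; try lia.
    by have := rec _ jt; lia.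
  by rewrite jt; lia.
- by left; rewrite /H.
- move=> c; rewrite -mem_chips -(perm_mem pp) => cin.
  have := nth_index 0 cin; have : index c pi < size pi by rewrite index_mem.
  rewrite sz; set i := index c pi => ipq <-; case: (ltnP i q) => iq.
    have [->|nit] := eqVneq i t; first by left; exists 0.
    by right; exists i; rewrite // /V /= (negbTE nit).
  have [ei|ni] := eqVneq i (p + q - 1).
    by right; exists t; rewrite // /V /= eqxx /E subn0 -ei.
  left; exists (p + q - 1 - i); first lia.
  rewrite /H ifF /E; last lia.
  by congr nth; lia.
- by move=> i iq; rewrite /V ifF //; lia.
- by move=> k kp; rewrite /H ifF //; lia.
Qed.

(* Same exchange, with the first entry of [pi]. *)
Lemma sigma_of_rtl_min p q pi s :
  0 < q -> perm_eq pi (iota 1 (p + q)) ->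
  (forall i j, i < q -> q <= j -> j < p + q -> nth 0 pi i <= nth 0 pi j) ->
  s < p ->
  (forall j, p + q - 1 - s < j -> j < p + q ->
     nth 0 pi (p + q - 1 - s) <= nth 0 pi j) ->
  exists sigma, perm_eq sigma (iota 1 (p + q - 1)) /\
    topples_to (p + q) (sigma_rp sigma (nth 0 pi (p + q - 1 - s)) p) pi.
Proof.
move=> q0 pp sep sp rec; have sz : size pi = p + q by rewrite (perm_size pp) size_iota.
pose E k := nth 0 pi (p + q - 1 - k).
pose H k j := if (j == 0) && (k == s) then nth 0 pi 0 else E k.
pose V k j := if (j == 0) && (k <= s) then E s else nth 0 pi j.
have sepE k j : k < p -> j < q -> nth 0 pi j <= E k by move=> kp jq; apply: sep; lia.
apply: (@sigma_of_grid p q _ H V) => //; first by lia.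
- have : E s \in iota 1 (p + q) by rewrite -(perm_mem pp) mem_nth // sz; lia.
  by rewrite mem_chips.
(* Column [0] carries [E s] down to row [s]; [rec] gives [E s <= E k] for [k < s], so these
   crossings exchange nothing. *)
- move=> k [|j] kp jq; rewrite /H /V /=; last by have := sepE _ _ kp jq; lia.
  have := sepE _ _ kp jq; have := sepE _ _ sp jq; case: (ltngtP k s) => ks; try lia.
    by have : E s <= E k by [apply: rec; lia]; lia.
  by rewrite ks; lia.
- by right; rewrite /V.
- move=> c; rewrite -mem_chips -(perm_mem pp) => cin.
  have := nth_index 0 cin; have : index c pi < size pi by rewrite index_mem.
  rewrite sz; set i := index c pi => ipq <-; case: (ltnP i q) => iq.
    have [->|ni] := eqVneq i 0; first by left; exists s; rewrite // /H !eqxx.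
    by right; exists i; rewrite // /V (negbTE ni).
  have [ei|ni] := eqVneq i (p + q - 1 - s).
    by right; exists 0; rewrite // /V /= /E -ei.
  left; exists (p + q - 1 - i); first lia.
  rewrite /H ifF /E; last lia.
  by congr nth; lia.
- by move=> i iq; rewrite /V ifF //; lia.
- by move=> k kp; rewrite /H ifF //; lia.
Qed.

Theorem theorem2p13 (n p r : nat) (pi : seq nat) :
  (2 <= n)%N -> (1 <= p <= n - 1)%N -> (1 <= r <= n)%N ->
  perm_eq pi (iota 1 n) -> p_resultant n p pi ->
  ((exists sigma : seq nat,
       perm_eq sigma (iota 1 (n - 1)) /\ topples_to n (sigma_rp sigma r p) pi)
   <->
   (((r <= n - p)%N -> ltr_max (pi_left n p pi) r) /\
    ((n - p < r)%N -> rtl_min (pi_right n p pi) r))).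
Proof.
move=> n2 pn rn pp [pos [inS tt]].
have p0 : 0 < p by lia.
have [q en] : exists q, n = p + q by exists (n - p); lia.
have q0 : 0 < q by lia.
rewrite {n}en in n2 pn rn pp inS tt *; rewrite /pi_left /pi_right addKn.
have up : uniq pi by rewrite (perm_uniq pp) iota_uniq.
have sz : size pi = p + q by rewrite (perm_size pp) size_iota.
(* Resultance of [pi] enters here: any grid ending in [pi] separates its two parts. *)
have sep := topples_to_separated (in_S_layout p0 q0 inS) tt.
have small := perm_separated pp (leq_addl p q) sep.
have [t tn er] : exists2 t, t < p + q & r = nth 0 pi t.
  have rpi : r \in pi by rewrite (perm_mem pp) mem_chips.
  by exists (index r pi); rewrite ?nth_index // -sz index_mem.
(* By [small], the condition [r <= q] on the value becomes [t < q] on the position. *)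
rewrite er ltnNge (small _ tn) -leqNgt; split=> [[sigma [ps tts]]|[low high]].
  rewrite -er in tts; have [h [v [v0 lay]]] := sigma_layout p0 q0 rn ps.
  have [low high] := layout_record p0 q0 lay tts tn (etrans (esym er) (esym v0)).
  split=> [tq|qt].
  - by apply/ltr_max_take => //; [rewrite sz leq_addl|apply: low].
  - by apply/rtl_min_drop; rewrite ?sz //; apply: high.
case: (ltnP t q) => [tq|qt].
  apply: sigma_of_ltr_max => //; apply/(@ltr_max_take _ q) => //; last exact: low.
  by rewrite sz leq_addl.
(* Position [t] of the right part is the end of horizontal line [p + q - 1 - t]. *)
have et : t = p + q - 1 - (p + q - 1 - t) by lia.
rewrite et; apply: sigma_of_rtl_min => //; first lia.
by rewrite -et -sz; apply/(@rtl_min_drop _ q); rewrite ?sz //; apply: high.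
Qed.
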